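(* Let $\mathbf G$ be an abelian group. Define a map $$\gamma\colon\mathrm{MinQVar}_0(\mathbf G)\to D(\mathbf G)\quad\text{by}\quad \mathcal R\mapsto\langle K_{\mathcal R},\mathbf U_{\mathcal R}\rangle,$$ and a map $$\delta\colon D(\mathbf G)\to\mathrm{MinQVar}_0(\mathbf G)\quad\text{by}\quad \langle K,\mathbf U\rangle\mapsto\mathcal Q\bigl(\mathbf N(K,\mathbf G,\mathbf U)\bigr).$$ Then $\gamma$ and $\delta$ are reciprocal (mutually inverse) bijections.
   Context: Let $\mathbf G=\langle G;\cdot,\mathrm{id}\rangle$ be an abelian group (its identity is also written $1$). A $\mathbf G$-semilattice is an algebra $\mathbf A=\langle A;\wedge,G\rangle$ with a binary operation $\wedge$ and each $g\in G$ acting as a unary operation on $A$, such that: $\wedge$ is associative, idempotent and commutative; $\mathrm{id}(x)=x$; $f(g(x))=(f\cdot g)(x)$ for all $f,g\in G$; and $g(x)\wedge g(y)=g(x\wedge y)$ for all $g\in G$. The order is $x\le y\iff x\wedge y=x$; the least element, if it exists, is called the zero and denoted $o$. $\mathbf A$ is trivial if $|A|=1$. For a subgroup $K$ of $\mathbf G$, $\mathbf K$ denotes $K$ as a group, and $\mathbf K$-semilattices are defined analogously. A quasi-identity is a universally quantified sentence $(p_1\approx q_1\ \&\cdots\&\ p_n\approx q_n)\Rightarrow p\approx q$ with $n\ge 0$ and $p_i,q_i,p,q$ terms. A quasivariety is a class of similar algebras defined by quasi-identities; $\mathcal Q(\mathbf A)$ is the least quasivariety containing $\mathbf A$. A quasivariety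 is trivial if it consists of trivial algebras. A nontrivial quasivariety is minimal if its only proper subquasivariety is the trivial one. $\mathbf F_{\mathcal R}(1)$, or $\mathbf F_{\mathcal R}(a)$, is the free algebra of $\mathcal R$ on one free generator $a$. $\mathrm{MinQVar}(\mathbf G)$ is the set of minimal quasivarieties of $\mathbf G$-semilattices; $\mathrm{MinQVar}_0(\mathbf G)$ is the set of those $\mathcal R\in\mathrm{MinQVar}(\mathbf G)$ for which $\mathbf F_{\mathcal R}(1)$ has a zero and at least two elements; $\mathrm{MinQVar}_2(\mathbf G)$ is the set of those $\mathcal R\in\mathrm{MinQVar}(\mathbf G)$ for which $\mathbf F_{\mathcal R}(1)$ has no zero. For $\mathcal R\in\mathrm{MinQVar}_0(\mathbf G)$ with $\mathbf A=\mathbf F_{\mathcal R}(a)$, put $K_{\mathcal R}=\{g\in G: a\wedge g(a)\ne o\}$ (this is a subgroup of $\mathbf G$), and with $K=K_{\mathcal R}$ let $\mathbf U_{\mathcal R}=\langle U;\wedge,K\rangle$, where $U=\{t(a): t$ a unary term in the language of $\mathbf K$-semilattices$\}$. Let $\mathrm{Sub}(\mathbf G)$ be the set of all subgroups of $\mathbf G$, and let $\mathbf o$ denote the one-element semilattice (over the relevant group $\mathbf K$). The set $D(\mathbf G)$ is $$\{\langle K,\mathbf o\rangle: K\in\mathrm{Sub}(\mathbf G)\setminus\{G\}\}\cup\{\langle K,\mathbf F_{\mathcal S}(1)\rangle: K\in\mathrm{Sub}(\mathbf G)\setminus\{\{1\},G\},\ \mathcal S\in\mathrm{MinQVar}_2(\mathbf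 K)\}.$$ The second components of elements of $D(\mathbf G)$ are understood up to isomorphism of $\mathbf K$-semilattices (isomorphic algebras are treated as equal). For a subgroup $K$ of $\mathbf G$ and a $\mathbf K$-semilattice $\mathbf U$, choose a system $T\subseteq G$ of representatives of the cosets of $K$ (i.e. $|T\cap gK|=1$ for all $g\in G$) with $T\cap K=\{1\}$. Then $\mathbf N(K,\mathbf G,\mathbf U)$ is the $\mathbf G$-semilattice (independent of $T$ up to isomorphism) on the set $\{o\}\cup(U\times T)$, where $o$ is a new element, with $g(\langle u,t\rangle)=\langle (gtf^{-1})(u),f\rangle$ where $f$ is the unique element of $T\cap gtK$ (so $gtf^{-1}\in K$), $g(o)=o$ for $g\in G$; $o$ meets every element in $o$; $\langle u_1,t\rangle\wedge\langle u_2,t\rangle=\langle u_1\wedge u_2,t\rangle$; and $\langle u_1,t_1\rangle\wedge\langle u_2,t_2\rangle=o$ if $t_1\ne t_2$. *)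

(* Defs.v *)
From HB Require Import structures.
From mathcomp Require Import all_boot ssralg.
From mathcomp Require Import boolp classical_sets.

Set Implicit Arguments.
Unset Strict Implicit.
Unset Printing Implicit Defensive.

Import GRing.Theory.

Local Open Scope classical_set_scope.
Local Open Scope ring_scope.
Local Open Scope quotient_scope.

(* Abelian groups are zmodTypes, hence written additively: the identity id
   (also written 1) is [0], the product f * g is [f + g], and g t f^-1 is
   [g + t - f]. Algebras have a nonempty carrier, as usual in universal
   algebra. *)
Record gsl (G : zmodType) : Type := GSL {
  carrier :> Type ;
  meet : carrier -> carrier -> carrier ;
  act : G -> carrier -> carrier ;
  carrier_inhabited : inhabited carrier ;
  meetA : associative meet ;
  meetxx : idempotent_op meet ;
  meetC : commutative meet ;
  act0 : forall x, act 0 x = x ;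
  actD : forall f g x, act f (act g x) = act (f + g) x ;
  act_meet : forall g x y, meet (act g x) (act g y) = act g (meet x y)
}.
Arguments meet {G A} x y : rename.
Arguments act {G A} f x : rename.

Section Semilattices.
Variable G : zmodType.

Definition gle (A : gsl G) (x y : A) : Prop := meet x y = x.

Definition is_zero (A : gsl G) (o : A) : Prop := forall x : A, gle o x.

Definition trivial_gsl (A : gsl G) : Prop := exists x : A, forall y : A, y = x.

End Semilattices.

(* Terms in the language of G-semilattices with variables in X. *)
Inductive term (G : zmodType) (X : Type) : Type :=
| Var of X
| TMeet of term G X & term G X
| TAct of G & term G X.
Arguments Var {G X}.

HB.instance Definition _ (G : zmodType) (X : Type) :=
  gen_eqMixin (term G X).
HB.instance Definition _ (G : zmodType) (X : Type) :=
  gen_choiceMixin (term G X).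

Section Quasivarieties.
Variable G : zmodType.

Fixpoint eval (A : gsl G) (X : Type) (v : X -> A) (t : term G X) : A :=
  match t with
  | Var x => v x
  | TMeet s t => meet (eval v s) (eval v t)
  | TAct g t => act g (eval v t)
  end.

Record quasi_identity : Type := QuasiIdentity {
  premises : seq (term G nat * term G nat) ;
  conclusion : term G nat * term G nat
}.

Definition holds_in (A : gsl G) (q : quasi_identity) : Prop :=
  forall v : nat -> A,
    (forall p, p \in premises q -> eval v p.1 = eval v p.2) ->
    eval v (conclusion q).1 = eval v (conclusion q).2.

(* Classes of G-semilattices. A set from classical_sets would put the class in
   the universe of choiceTypes, hence force the carriers strictly below it,
   which excludes free algebras. *)
Definition gclass : Type := gsl G -> Prop.

Definition gsubclass (R S : gclass) : Prop := forall A, R A -> S A.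

Definition quasivariety (R : gclass) : Prop :=
  exists S : set quasi_identity, R = (fun A => forall q, S q -> holds_in A q).

Definition Qvar (A : gsl G) : gclass := fun B =>
  forall R : gclass, quasivariety R -> R A -> R B.

Definition trivial_class (R : gclass) : Prop :=
  forall A, R A -> trivial_gsl A.

Definition MinQVar (R : gclass) : Prop :=
  [/\ quasivariety R, ~ trivial_class R &
      forall S, quasivariety S -> gsubclass S R -> S <> R -> trivial_class S].

End Quasivarieties.

(* F_R(a): unary terms modulo the identities valid in R, the generator a being
   the class of the variable. *)
Section FreeAlgebra.
Variables (G : zmodType) (R : gclass G).

Definition free_rel (s t : term G unit) : bool :=
  `[< forall A : gsl G, R A ->
      forall x : A, eval (fun=> x) s = eval (fun=> x) t >].

Lemma free_rel_refl : reflexive free_rel.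
Proof. by move=> s; apply/asboolP. Qed.

Lemma free_rel_sym : symmetric free_rel.
Proof. by move=> s t; apply/asboolP/asboolP => H A RA x; rewrite H. Qed.

Lemma free_rel_trans : transitive free_rel.
Proof.
by move=> t s u /asboolP st /asboolP tu; apply/asboolP => A RA x; rewrite st// tu.
Qed.

Canonical free_equiv : equiv_rel (term G unit) :=
  EquivRel free_rel free_rel_refl free_rel_sym free_rel_trans.

Definition free_carrier : Type := {eq_quot free_equiv}.
HB.instance Definition _ := EqQuotient.on free_carrier.

Definition free_meet (x y : free_carrier) : free_carrier :=
  \pi_free_carrier (TMeet (repr x) (repr y)).
Definition free_act (g : G) (x : free_carrier) : free_carrier :=
  \pi_free_carrier (TAct g (repr x)).
Definition free_gen : free_carrier := \pi_free_carrier (Var tt).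

Lemma free_eq (s t : term G unit) :
  (forall A : gsl G, R A ->
     forall x : A, eval (fun=> x) s = eval (fun=> x) t) <->
  \pi_free_carrier s = \pi_free_carrier t.
Proof.
split=> [H|/eqmodP /asboolP //].
by apply/eqmodP/asboolP.
Qed.

Lemma eval_repr_pi (A : gsl G) (x : A) (t : term G unit) : R A ->
  eval (fun=> x) (repr (\pi_free_carrier t)) = eval (fun=> x) t.
Proof. by move=> RA; apply: (free_eq _ _).2 => //; rewrite reprK. Qed.

Lemma free_meetE s t :
  free_meet (\pi_free_carrier s) (\pi_free_carrier t) = \pi_free_carrier (TMeet s t).
Proof. by apply/free_eq => A RA x /=; rewrite !eval_repr_pi. Qed.

Lemma free_actE g t :
  free_act g (\pi_free_carrier t) = \pi_free_carrier (TAct g t).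
Proof. by apply/free_eq => A RA x /=; rewrite !eval_repr_pi. Qed.

Lemma free_inhabited : inhabited free_carrier.
Proof. exact: inhabits free_gen. Qed.

Lemma free_meetA : associative free_meet.
Proof.
elim/quotW=> x; elim/quotW=> y; elim/quotW=> z; rewrite !free_meetE.
by apply/free_eq => A RA a /=; rewrite ?eval_repr_pi//= meetA.
Qed.

Lemma free_meetxx : idempotent_op free_meet.
Proof.
elim/quotW=> x; rewrite !free_meetE.
by apply/free_eq => A RA a /=; rewrite ?eval_repr_pi//= meetxx.
Qed.

Lemma free_meetC : commutative free_meet.
Proof.
elim/quotW=> x; elim/quotW=> y; rewrite !free_meetE.
by apply/free_eq => A RA a /=; rewrite ?eval_repr_pi//= meetC.
Qed.

Lemma free_act0 x : free_act 0 x = x.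
Proof.
elim/quotW: x => x; rewrite !free_actE.
by apply/free_eq => A RA a /=; rewrite ?eval_repr_pi//= act0.
Qed.

Lemma free_actD f g x : free_act f (free_act g x) = free_act (f + g) x.
Proof.
elim/quotW: x => x; rewrite !free_actE.
by apply/free_eq => A RA a /=; rewrite ?eval_repr_pi//= actD.
Qed.

Lemma free_act_meet g x y :
  free_meet (free_act g x) (free_act g y) = free_act g (free_meet x y).
Proof.
elim/quotW: x => x; elim/quotW: y => y; rewrite !(free_actE, free_meetE).
by apply/free_eq => A RA a /=; rewrite ?eval_repr_pi//= act_meet.
Qed.

Definition free1 : gsl G :=
  GSL free_inhabited free_meetA free_meetxx free_meetC
      free_act0 free_actD free_act_meet.

Definition gen1 : free1 := free_gen.

Lemma eval_free (X : Type) (v : X -> term G unit) (t : term G X)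
    (A : gsl G) (x : A) : R A ->
  eval (fun=> x) (repr (eval (A := free1) (fun i => \pi_free_carrier (v i)) t))
  = eval (fun i => eval (fun=> x) (v i)) t.
Proof.
move=> RA; elim: t => [i|s IHs t IHt|g t IHt] /=.
- exact: eval_repr_pi.
- by rewrite eval_repr_pi//= IHs IHt.
- by rewrite eval_repr_pi//= IHt.
Qed.

Lemma eval_gen1 (t : term G unit) :
  eval (A := free1) (fun=> gen1) t = \pi_free_carrier t.
Proof.
elim: t => [[]|s IHs t IHt|g t IHt] //=.
- by rewrite IHs IHt; exact: free_meetE.
- by rewrite IHt; exact: free_actE.
Qed.

Lemma free1_in : quasivariety R -> R free1.
Proof.
case=> S RE; rewrite RE => q Sq v Hv.
pose w i : term G unit := repr (v i : free_carrier).
have vE : v = fun i => \pi_free_carrier (w i).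
  by apply/funext => i; rewrite reprK.
rewrite vE in Hv *.
rewrite -[LHS](@reprK _ free_carrier) -[RHS](@reprK _ free_carrier).
apply/free_eq => A RA x; rewrite !eval_free//.
have : holds_in A q by move: RA; rewrite RE; apply.
by apply=> p pq; rewrite -!eval_free// Hv.
Qed.

Lemma free1_universal (A : gsl G) (x : A) : R A ->
  exists! phi : free1 -> A,
    [/\ {morph phi : y z / meet y z},
        forall g, {morph phi : y / act g y} & phi gen1 = x].
Proof.
move=> RA; exists (fun y => eval (fun=> x) (repr (y : free_carrier))); split.
  split=> [y z|g y|]; by rewrite eval_repr_pi.
move=> phi [phiM phiA phiG]; apply/funext => y.
rewrite -[in RHS](reprK (y : free_carrier)) -eval_gen1.
elim: (repr _) => [[]|s IHs t IHt|g t IHt] //=.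
- by rewrite phiM IHs IHt.
- by rewrite phiA IHt.
Qed.

End FreeAlgebra.

Section MinimalQuasivarieties.
Variable G : zmodType.

Definition MinQVar0 (R : gclass G) : Prop :=
  [/\ MinQVar R, exists o : free1 R, is_zero o &
      exists x y : free1 R, x <> y].

Definition MinQVar2 (R : gclass G) : Prop :=
  MinQVar R /\ ~ exists o : free1 R, is_zero o.

End MinimalQuasivarieties.

(* A subgroup of G is a K : zmodClosed G; [subgrp K] is the same subgroup as a
   group. *)
Definition subgrp (G : zmodType) (K : zmodClosed G) : Type :=
  {x : G | x \in K}.
HB.instance Definition _ (G : zmodType) (K : zmodClosed G) :=
  SubChoice.on (subgrp K).
HB.instance Definition _ (G : zmodType) (K : zmodClosed G) :=
  [SubChoice_isSubZmodule of subgrp K by <:].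

Section Reduct.
Variables (G : zmodType) (K : zmodClosed G) (A : gsl G).

Definition reduct_act (k : subgrp K) (x : A) : A := act (val k) x.

Lemma reduct_act0 x : reduct_act 0 x = x.
Proof. exact: act0. Qed.
Lemma reduct_actD f g x :
  reduct_act f (reduct_act g x) = reduct_act (f + g) x.
Proof. exact: actD. Qed.
Lemma reduct_act_meet g x y :
  meet (reduct_act g x) (reduct_act g y) = reduct_act g (meet x y).
Proof. exact: act_meet. Qed.

Definition reduct : gsl (subgrp K) :=
  GSL (carrier_inhabited A) (@meetA _ A) (@meetxx _ A) (@meetC _ A)
      reduct_act0 reduct_actD reduct_act_meet.

End Reduct.

(* The subalgebra {t(a) : t a unary term} of A generated by a. *)
Section MonogenicSubalgebra.
Variables (G : zmodType) (A : gsl G) (a : A).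

Definition mono_set : set A :=
  [set y | exists t : term G unit, y = eval (fun=> a) t].

Lemma mono_meet_closed x y : mono_set x -> mono_set y -> mono_set (meet x y).
Proof. by move=> [s ->] [t ->]; exists (TMeet s t). Qed.

Lemma mono_act_closed g x : mono_set x -> mono_set (act g x).
Proof. by move=> [t ->]; exists (TAct g t). Qed.

Lemma mono_gen_closed : mono_set a.
Proof. by exists (Var tt). Qed.

Definition mono_carrier : Type := {y : A | mono_set y}.

Definition mono_meet (x y : mono_carrier) : mono_carrier :=
  exist mono_set (meet (sval x) (sval y))
    (mono_meet_closed (svalP x) (svalP y)).
Definition mono_act (g : G) (x : mono_carrier) : mono_carrier :=
  exist mono_set (act g (sval x)) (mono_act_closed g (svalP x)).

Lemma mono_inhabited : inhabited mono_carrier.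
Proof. exact: inhabits (exist mono_set a mono_gen_closed). Qed.
Lemma mono_meetA : associative mono_meet.
Proof. by move=> x y z; apply: eq_exist; exact: meetA. Qed.
Lemma mono_meetxx : idempotent_op mono_meet.
Proof. by move=> [x xP]; apply: eq_exist; exact: meetxx. Qed.
Lemma mono_meetC : commutative mono_meet.
Proof. by move=> x y; apply: eq_exist; exact: meetC. Qed.
Lemma mono_act0 x : mono_act 0 x = x.
Proof. by case: x => x xP; apply: eq_exist; exact: act0. Qed.
Lemma mono_actD f g x : mono_act f (mono_act g x) = mono_act (f + g) x.
Proof. by apply: eq_exist; exact: actD. Qed.
Lemma mono_act_meet g x y :
  mono_meet (mono_act g x) (mono_act g y) = mono_act g (mono_meet x y).
Proof. by apply: eq_exist; exact: act_meet. Qed.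

Definition mono : gsl G :=
  GSL mono_inhabited mono_meetA mono_meetxx mono_meetC
      mono_act0 mono_actD mono_act_meet.

End MonogenicSubalgebra.

Section Lemmas.
Variable G : zmodType.

Section Order.
Variable A : gsl G.
Implicit Types x y z : A.

Lemma gle_trans x y z : gle x y -> gle y z -> gle x z.
Proof. by rewrite /gle => xy yz; rewrite -{1}xy -meetA yz. Qed.

Lemma gle_refl x : gle x x. Proof. exact: meetxx. Qed.

Lemma gle_anti x y : gle x y -> gle y x -> x = y.
Proof. by rewrite /gle => xy yx; rewrite -xy meetC yx. Qed.

Lemma gle_meetl x y : gle (meet x y) x.
Proof. by rewrite /gle meetC meetA meetxx. Qed.

Lemma gle_meetr x y : gle (meet x y) y.
Proof. by rewrite meetC; exact: gle_meetl. Qed.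

Lemma gle_meet2 x y x' y' :
  gle x x' -> gle y y' -> gle (meet x y) (meet x' y').
Proof.
rewrite /gle => xx' yy'.
rewrite -meetA [meet y _]meetA [meet y x']meetC -[meet (meet x' y) _]meetA yy'.
by rewrite meetA xx'.
Qed.

Lemma gle_act g x y : gle x y -> gle (act g x) (act g y).
Proof. by rewrite /gle act_meet => ->. Qed.

Lemma gle_eval (t : term G unit) x y :
  gle x y -> gle (eval (fun=> x) t) (eval (fun=> y) t).
Proof.
move=> xy; elim: t => [_|s IHs t IHt|g t IHt] //=.
- exact: gle_meet2.
- exact: gle_act.
Qed.

Lemma eval_act (t : term G unit) k x :
  eval (fun=> act k x) t = act k (eval (fun=> x) t).
Proof.
elim: t => [_|s IHs t IHt|g t IHt] //=.
- by rewrite IHs IHt act_meet.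
- by rewrite IHt !actD addrC.
Qed.

Lemma eval_le_act (t : term G unit) x :
  exists k, gle (eval (fun=> x) t) (act k x).
Proof.
elim: t => [_|s [k sk] t _|g t [k tk]] /=.
- by exists 0; rewrite act0; exact: gle_refl.
- by exists k; apply: gle_trans sk; exact: gle_meetl.
- by exists (g + k); rewrite -actD; exact: gle_act.
Qed.

Lemma zero_min (o x : A) : is_zero o -> gle x o -> x = o.
Proof. by move=> oz xo; apply: gle_anti => //; exact: oz. Qed.

Lemma act_zero (o : A) g : is_zero o -> act g o = o.
Proof.
move=> oz; apply: esym; apply: zero_min => //.
have := gle_act g (oz (act (- g) o)).
by rewrite actD subrr act0 => /(zero_min oz) ->; exact: oz.
Qed.

End Order.

Lemma eval_morph (A B : gsl G) (phi : A -> B) (X : Type) (v : X -> A)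
    (t : term G X) :
  {morph phi : x y / meet x y} -> (forall g, {morph phi : x / act g x}) ->
  phi (eval v t) = eval (phi \o v) t.
Proof.
move=> phiM phiA; elim: t => [x|s IHs t IHt|g t IHt] //=.
- by rewrite phiM IHs IHt.
- by rewrite phiA IHt.
Qed.

Lemma quasivariety_emb (R : gclass G) (A B : gsl G) (phi : A -> B) :
  {morph phi : x y / meet x y} -> (forall g, {morph phi : x / act g x}) ->
  injective phi -> quasivariety R -> R B -> R A.
Proof.
move=> phiM phiA phiI [S ->] RB q Sq v Hv.
apply: phiI; rewrite !eval_morph//; apply: (RB q Sq) => p pq.
by rewrite -!eval_morph// Hv.
Qed.

Lemma mono_in (R : gclass G) (A : gsl G) (a : A) :
  quasivariety R -> R A -> R (mono a).
Proof.
move=> qR RA; apply: (@quasivariety_emb R (mono a) A (fun y => sval y)) => //.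
by move=> [x xP] [y yP] /= xy; apply: eq_exist.
Qed.

Fixpoint rename X Y (f : X -> Y) (t : term G X) : term G Y :=
  match t with
  | Var x => Var (f x)
  | TMeet s t => TMeet (rename f s) (rename f t)
  | TAct g t => TAct g (rename f t)
  end.

Lemma eval_rename X Y (f : X -> Y) (t : term G X) (A : gsl G) (v : Y -> A) :
  eval v (rename f t) = eval (v \o f) t.
Proof. by elim: t => [|s /= -> t ->|g t /= ->]. Qed.

Lemma quasivariety_identity (R : gclass G) (s t : term G unit) :
  quasivariety R ->
  quasivariety (fun A => R A /\
    forall x : A, eval (fun=> x) s = eval (fun=> x) t).
Proof.
move=> [S RE]; pose f (u : unit) := 0%N.
pose q := QuasiIdentity [::] (rename f s, rename f t).
exists (S `|` [set q]); apply/funext => A; apply/propext; split=> /=.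
  rewrite RE => -[HA st] p [/HA//|->] v _ /=.
  by rewrite !eval_rename; exact: st (v 0%N).
move=> H; split; first by rewrite RE => p Sp; apply: H; left.
move=> x; have /(_ (fun=> x)) := H q (or_intror erefl).
by rewrite /= !eval_rename; apply.
Qed.

End Lemmas.

(* K_R, with a proof that it is a subgroup. *)
Section KR.
Variables (G : zmodType) (R : gclass G).

Definition KR of MinQVar0 R : {pred G} := fun g =>
  `[< forall o : free1 R, is_zero o -> meet (gen1 R) (act g (gen1 R)) <> o >].

Hypothesis hR : MinQVar0 R.
Let a := gen1 R.

Lemma KRP (o : free1 R) g :
  is_zero o -> reflect (meet a (act g a) <> o) (g \in KR hR).
Proof.
move=> oz; apply: (iffP (asboolP _)) => [H|H o' o'z]; first exact: H.
by rewrite (zero_min oz (o'z o)).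
Qed.

Lemma free1_eval (y : free1 R) : exists t : term G unit, y = eval (fun=> a) t.
Proof.
by exists (repr (y : free_carrier R)); rewrite eval_gen1 reprK.
Qed.

Lemma gen1_neq0 (o : free1 R) : is_zero o -> a <> o.
Proof.
move=> oz ao; case: hR => _ _ [x [y]]; apply.
suff all0 z : z = o by rewrite (all0 x) (all0 y).
have [t ->] := free1_eval z; have [k] := eval_le_act t a.
by rewrite ao act_zero// => /zero_min; apply.
Qed.

Lemma meet_translate_neq0 (o b : free1 R) h : is_zero o ->
  gle b a -> b <> o -> meet a (act h a) <> o -> meet b (act h b) <> o.
Proof.
move=> oz ba b0 ah0 bh0; apply: ah0.
case: hR => -[qR _ minR] _ _.
have RF := free1_in qR.
have [t ot] := free1_eval o.
pose s := TMeet (Var tt) (TAct h (Var tt)) : term G unit.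
pose S : gclass G :=
  fun A => R A /\ forall x : A, eval (fun=> x) s = eval (fun=> x) t.
have low (y : free1 R) : mono_set b y ->
    eval (fun=> y) s = o /\ eval (fun=> y) t = o.
  move=> [u ->]; have [k le_k] := eval_le_act u b; split.
    apply: (zero_min oz); rewrite -(act_zero k oz) -bh0 -act_meet.
    by rewrite actD addrC -actD; apply: gle_meet2 => //; exact: gle_act.
  apply: (zero_min oz); rewrite -(act_zero k oz) ot -eval_act.
  by apply: gle_eval; apply: gle_trans le_k _; exact: gle_act.
have Sb : S (mono b).
  split; first exact: mono_in.
  move=> [y yb]; have [ys yt] := low y yb.
  pose phi (z : mono b) : free1 R := sval z.
  have phiM : {morph phi : z z' / meet z z'} by [].
  have phiA g : {morph phi : z / act g z} by [].
  have phiI (z z' : mono b) : phi z = phi z' -> z = z'.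
    by case: z z' => [z zb] [z' zb'] /= zz'; apply: eq_exist.
  by apply: phiI; rewrite !eval_morph// [LHS]ys [RHS]yt.
have SR : S = R.
  apply: contrapT => /minR.
  have SsR : gsubclass S R by move=> A [].
  move=> /(_ (quasivariety_identity s t qR) SsR (mono b) Sb) [x allx].
  have yb : mono_set b (eval (fun=> b) t) by exists t.
  have := allx (exist _ b (mono_gen_closed b)).
  rewrite -(allx (exist _ _ yb)) => -[] /= bE.
  by apply: b0; rewrite bE; case: (low b (mono_gen_closed b)).
have [_ Ha] : S (free1 R) by rewrite SR.
by rewrite [RHS]ot; exact: (Ha a).
Qed.

Lemma KR_zmod_closed : zmod_closed (KR hR).
Proof.
have [_ [o oz] _] := hR.
have a0 := gen1_neq0 oz.
have K0 : 0 \in KR hR by apply/(KRP _ oz); rewrite act0 meetxx.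
have KN g : g \in KR hR -> - g \in KR hR.
  move=> /(KRP _ oz) ga; apply/(KRP _ oz) => ag; apply: ga.
  have := congr1 (act g) ag.
  by rewrite -act_meet actD subrr act0 meetC (act_zero g oz).
split=> // g h /(KRP _ oz) ga /KN/(KRP _ oz) ha; apply/(KRP _ oz) => gha.
apply: (meet_translate_neq0 oz (gle_meetl a (act g a)) ga ha).
apply: (zero_min oz); rewrite -gha addrC -actD.
apply: gle_meet2; first exact: gle_meetl.
by apply: gle_act; exact: gle_meetr.
Qed.

HB.instance Definition _ := GRing.isZmodClosed.Build G (KR hR) KR_zmod_closed.

End KR.

(* Pairs <K, U> with U a K-semilattice. *)
Definition gpair (G : zmodType) : Type := {K : zmodClosed G & gsl (subgrp K)}.

(* Equality of pairs, with second components taken up to isomorphism. *)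
Definition gpair_eq (G : zmodType) (d d' : gpair G) : Prop :=
  projT1 d =i projT1 d' /\
  exists phi : projT2 d -> projT2 d',
    [/\ bijective phi, {morph phi : x y / meet x y} &
        forall (k : subgrp (projT1 d)) (k' : subgrp (projT1 d')),
          val k = val k' -> forall x, phi (act k x) = act k' (phi x)].

Definition iso (G : zmodType) (A B : gsl G) : Prop :=
  exists phi : A -> B,
    [/\ bijective phi, {morph phi : x y / meet x y} &
        forall g, {morph phi : x / act g x}].

(* Closed under [gpair_eq]: the one-element semilattice o and F_S(1) are given
   up to isomorphism. *)
Definition DG (G : zmodType) (d : gpair G) : Prop :=
  let K := projT1 d in let U := projT2 d in
  ~ (forall g, g \in K) /\
  (trivial_gsl U \/
   ~ (forall g, g \in K -> g = 0) /\
   exists S : gclass (subgrp K), MinQVar2 S /\ iso U (free1 S)).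

Section Gamma.
Variables (G : zmodType) (R : gclass G) (hR : MinQVar0 R).

Definition UR : gsl (subgrp (KR hR)) :=
  mono (gen1 R : reduct (KR hR) (free1 R)).

Definition gamma : gpair G :=
  existT (fun K : zmodClosed G => gsl (subgrp K)) (KR hR : zmodClosed G) UR.

End Gamma.

(* A system of representatives T of the cosets of K, with T /\ K = {0};
   t lies in the coset of g iff t - g \in K. *)
Record coset_transversal (G : zmodType) (K : zmodClosed G) : Type :=
  CosetTransversal {
  tset : set G ;
  tset_coset : forall g, exists! t, tset t /\ t - g \in K ;
  tset_K : forall t, tset t /\ t \in K <-> t = 0
}.

Lemma coset_transversal_exists (G : zmodType) (K : zmodClosed G) :
  inhabited (coset_transversal K).
Proof.
pose P (g : G) : set G := [set t | t - g \in K].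
pose r g := if g \in K then 0 else xget 0 (P g).
have rP g : r g - g \in K.
  rewrite /r; case: ifP => gK; first by rewrite sub0r rpredN.
  by apply: (@xgetPex _ 0 (P g)); exists g; rewrite /P /= subrr rpred0.
have KE g h : g - h \in K -> (g \in K) = (h \in K).
  by move=> ghK; rewrite -[g in LHS](subrK h) rpredDl.
have KB g h l : g - h \in K -> h - l \in K -> g - l \in K.
  by move=> gh hl; rewrite -(subrKA h) rpredD.
have KC g h : g - h \in K -> h - g \in K by rewrite -rpredN opprB.
have rE g h : g - h \in K -> r g = r h.
  move=> gh; rewrite /r (KE _ _ gh); case: ifP => // _; congr xget.
  by apply/seteqP; split=> t /= tK; [exact: KB tK gh|exact: KB tK (KC _ _ gh)].
constructor; apply: (@CosetTransversal G K (range r)).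
  move=> g; exists (r g); split; first by split=> //; exists g.
  by move=> _ [[h _ <-]] hg; apply: rE; exact: KB (KC _ _ hg) (rP h).
move=> t; split=> [[[g _ <-]]|->].
  by rewrite (KE _ _ (rP g)) /r => ->.
by split; [exists 0 => //; rewrite /r rpred0|exact: rpred0].
Qed.

(* N(K, G, U): None is o, and Some (u, t) is <u, t>. *)
Section N.
Variables (G : zmodType) (K : zmodClosed G) (T : coset_transversal K).
Variable U : gsl (subgrp K).

(* The element of T in the coset of g. *)
Definition trep (g : G) : G := xget 0 [set f | tset T f /\ f - g \in K].

Lemma trepP g : tset T (trep g) /\ trep g - g \in K.
Proof.
rewrite /trep; case: xgetP => [f _ //|H].
by have [f [Hf _]] := tset_coset T g; case: (H f).
Qed.

Lemma trep_coset g : g - trep g \in K.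
Proof. by rewrite -rpredN opprB; case: (trepP g). Qed.

Lemma trep_uniq g t : tset T t -> t - g \in K -> trep g = t.
Proof.
move=> Tt tg; have [f [_ fu]] := tset_coset T g.
by rewrite -(fu (trep g) (trepP g)) (fu t).
Qed.

Definition N_carrier : Type := option (U * {t : G | tset T t}).

Definition N_act (g : G) (x : N_carrier) : N_carrier :=
  if x is Some (u, t) then
    Some (act (Sub (g + sval t - trep (g + sval t))
                 (trep_coset (g + sval t)) : subgrp K) u,
          exist (tset T) (trep (g + sval t)) (trepP (g + sval t)).1)
  else None.

Definition N_meet (x y : N_carrier) : N_carrier :=
  match x, y with
  | Some (u1, t1), Some (u2, t2) =>
      if `[< t1 = t2 >] then Some (meet u1 u2, t1) else None
  | _, _ => None
  end.

Lemma N_inhabited : inhabited N_carrier.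
Proof. exact: inhabits None. Qed.

Lemma N_meetA : associative N_meet.
Proof.
move=> [[u1 t1]|] [[u2 t2]|] [[u3 t3]|] //=; last by case: asboolP.
case: (asboolP (t2 = t3)) => [<-|t23] /=.
  case: (asboolP (t1 = t2)) => [<-|//] /=.
  by rewrite asboolT// meetA.
case: (asboolP (t1 = t2)) => [->|//] /=.
by rewrite asboolF.
Qed.

Lemma N_meetxx : idempotent_op N_meet.
Proof. by case=> [[u t]|] //=; rewrite asboolT// meetxx. Qed.

Lemma N_meetC : commutative N_meet.
Proof.
move=> [[u1 t1]|] [[u2 t2]|] //=.
case: (asboolP (t1 = t2)) => [<-|t12]; first by rewrite asboolT// meetC.
by rewrite asboolF// => t21; apply: t12.
Qed.

Lemma N_act_eq (u : U) (k k' : subgrp K) (t t' : {t : G | tset T t}) :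
  val k = val k' -> sval t = sval t' ->
  Some (act k u, t) = Some (act k' u, t') :> N_carrier.
Proof.
move=> /val_inj -> tt'; congr (Some (_, _)).
by case: t t' tt' => [t Tt] [t' Tt'] /= tt'; exact: eq_exist.
Qed.

Lemma N_act0 x : N_act 0 x = x.
Proof.
case: x => [[u t]|] //=; rewrite -[in RHS](act0 u).
have tt : trep (0 + sval t) = sval t.
  by apply: trep_uniq; [exact: svalP|rewrite add0r subrr rpred0].
by apply: N_act_eq; rewrite /= ?tt ?add0r ?subrr.
Qed.

Lemma N_actD f g x : N_act f (N_act g x) = N_act (f + g) x.
Proof.
case: x => [[u t]|] //=; rewrite actD.
have tt : trep (f + trep (g + sval t)) = trep (f + g + sval t).
  apply: trep_uniq; first exact: (trepP _).1.
  rewrite -(subrKA (f + g + sval t)) rpredD//; first exact: (trepP _).2.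
  by rewrite -(addrA f) opprD addrACA subrr add0r trep_coset.
apply: N_act_eq; rewrite /= tt//.
rewrite [LHS]addrAC; congr (_ - _).
by rewrite -addrA [trep _ + _]addrC subrK addrA.
Qed.

Lemma N_act_meet g x y : N_meet (N_act g x) (N_act g y) = N_act g (N_meet x y).
Proof.
case: x y => [[u1 t1]|] [[u2 t2]|] //=.
case: (asboolP (t1 = t2)) => [<-|t12] /=; first by rewrite asboolT// act_meet.
rewrite asboolF// => -[] tt; apply: t12.
case: t1 t2 tt => [t1 Tt1] [t2 Tt2] /= tt; apply: eq_exist.
rewrite -(trep_uniq Tt1 (g := t1)) ?subrr ?rpred0//.
apply: trep_uniq => //.
have [] := trepP (g + t2); have := trep_coset (g + t1); rewrite tt => K1 _ K2.
have -> : t2 - t1 = - ((trep (g + t2) - (g + t2)) + (g + t1 - trep (g + t2))).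
  by rewrite [in RHS]addrC subrKA opprB opprD addrACA subrr add0r.
by rewrite rpredN rpredD.
Qed.

Definition Nsl : gsl G :=
  GSL N_inhabited N_meetA N_meetxx N_meetC N_act0 N_actD N_act_meet.

End N.

Definition delta (G : zmodType) (T : forall K : zmodClosed G, coset_transversal K)
    (d : gpair G) : gclass G :=
  Qvar (Nsl (T (projT1 d)) (projT2 d)).

(* Main.v *)
Require Import Defs.
From mathcomp Require Import all_boot ssralg.
From mathcomp Require Import boolp classical_sets.

(** The proof rests on a homogeneity property.  Call a monogenic
    G-semilattice A = <a> homogeneous if every unary equation s(x) = t(x)
    satisfied by some element x is satisfied by the generator a (hence, as unary
    terms commute, by every element); call it 0-homogeneous if this holds for
    the non-zero elements x.

    0-homogeneity is what minimality means for monogenic algebras.  If R is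
    minimal and F = F_R(1) is nontrivial, then any non-zero x of F generates a
    nontrivial subalgebra, which therefore generates R as a quasivariety, so
    that the unary equations of x are those of the free generator
    ([free1_homogeneous0]).  Conversely, suppose that A = <a> is nontrivial and
    0-homogeneous.  For s(a) <> t(a) the quasi-identity s(x) = t(x) => x <= y
    holds in A, as s(x) = t(x) only if x is the zero.  It then holds in every B
    of Q(A), so a non-zero element of B satisfies the same unary equations as a
    and generates a copy of A in B.  Hence Q(A) is minimal, and its free algebra
    on one generator is A ([homogeneous0_MinQVar], [free1_Qvar]).  An algebra
    that is homogeneous and nontrivial has no zero, as a zero is fixed by G.
    It follows that D(G) consists of the pairs (K, U) with K proper and U
    homogeneous ([DG_homogeneous]).

    The two constructions exchange these properties.  In F = F_R(1), with R in
    MinQVar_0(G), the K_R-terms never take the value o at a, so U_R avoids o and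
    inherits homogeneity from the 0-homogeneity of F; and K_R is proper since o
    is the value of some G-term at a.  In N(K, G, U), a unary term either
    vanishes identically or acts as a translate of a K-term applied to the
    first component ([N_term_normal]), so homogeneity of U gives
    0-homogeneity of N.

    Finally, N(K, G, U) embeds in every algebra with zero containing a copy of
    U whose translates by elements outside K are orthogonal to it, that is,
    meet it only in the zero ([N_emb]).
    This gives at once that the quasivariety of N depends only on (K, U) up to
    isomorphism, and that N(K_R, G, U_R) embeds in F_R(1), hence generates R.
    In the other direction F_R(1) is N itself when R = Q(N), and there K_R and
    U_R can be read off. *)

Set Implicit Arguments.
Unset Strict Implicit.
Unset Printing Implicit Defensive.

Import GRing.Theory.

Local Open Scope ring_scope.

(** * Terms in one variable *)

Section UnaryTerms.
Variable G : zmodType.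
Implicit Types A B : gsl G.
Implicit Types s t : term G unit.

Definition emb A B : Prop := exists phi : A -> B,
  [/\ injective phi, {morph phi : x y / meet x y} &
      forall g, {morph phi : x / act g x}].

Definition generates A (a : A) : Prop :=
  forall y, exists t, y = eval (fun=> a) t.

Lemma eval_meet A t (x y : A) :
  eval (fun=> meet x y) t = meet (eval (fun=> x) t) (eval (fun=> y) t).
Proof.
elim: t => [_|s IHs t IHt|g t IHt] //=; last by rewrite IHt act_meet.
rewrite IHs IHt -!meetA; congr meet.
by rewrite !meetA [meet (eval (fun=> y) s) _]meetC.
Qed.

(** Translations commute because [G] is abelian, and they distribute over
    meets; so unary terms, being meets of translations, commute. *)
Lemma eval_comm A s t (x : A) :
  eval (fun=> eval (fun=> x) t) s = eval (fun=> eval (fun=> x) s) t.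
Proof.
elim: s => [[]|s IHs s' IHs'|g s IHs] //=.
- by rewrite IHs IHs' eval_meet.
- by rewrite IHs eval_act.
Qed.

(** Every element is a term in the generator, and that term commutes with
    both sides. *)
Lemma generates_identity A (a : A) s t :
  generates a -> eval (fun=> a) s = eval (fun=> a) t ->
  forall x : A, eval (fun=> x) s = eval (fun=> x) t.
Proof.
by move=> gen st x; have [u ->] := gen x; rewrite eval_comm st eval_comm.
Qed.

Lemma eval_fixed A (a : A) t :
  (forall g, act g a = a) -> eval (fun=> a) t = a.
Proof.
by move=> fixa; elim: t => [[]|s /= -> t ->|g t /= ->] //; rewrite meetxx.
Qed.

Lemma generates_fixed_trivial A (a : A) :
  generates a -> (forall g, act g a = a) -> trivial_gsl A.
Proof.
by move=> gen fixa; exists a => y; have [t ->] := gen y; exact: eval_fixed.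
Qed.

(** Elements lie below translates of the generator, so a fixed element lies
    below every translate of it, hence below their meets. *)
Lemma generates_fixed_zero A (a x : A) :
  generates a -> (forall g, act g x = x) -> is_zero x.
Proof.
move=> gen fixx; have xa g : gle x (act g a).
  have [s xs] := gen x; have [k] := eval_le_act s a; rewrite -xs.
  by move/(gle_act (g - k)); rewrite fixx actD subrK.
have xt t : gle x (eval (fun=> a) t).
  have -> : x = eval (fun=> x) t by rewrite eval_fixed.
  by apply: gle_eval; rewrite -(act0 a).
by move=> y; have [t ->] := gen y.
Qed.

Lemma act_inj A g : injective (act g : A -> A).
Proof.
by move=> x y xy; rewrite -(act0 x) -(act0 y) -(addNr g) -!actD xy.
Qed.

(** The map is [t(a) -> t(b)]: the equations satisfied by [a] make it well
    defined, those satisfied by [b] make it injective. *)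
Lemma generates_emb A B (a : A) (b : B) : generates a ->
    (forall s t, eval (fun=> a) s = eval (fun=> a) t <->
                 eval (fun=> b) s = eval (fun=> b) t) ->
  exists phi : A -> B,
    [/\ injective phi, {morph phi : x y / meet x y},
        forall g, {morph phi : x / act g x} &
        forall t, phi (eval (fun=> a) t) = eval (fun=> b) t].
Proof.
move=> gen ab; have [w wE] := choice gen.
pose phi y := eval (fun=> b) (w y).
have phiE t : phi (eval (fun=> a) t) = eval (fun=> b) t.
  by apply/ab; rewrite -wE.
exists phi; split=> [x y xy|x y|g x|//].
- by rewrite (wE x) (wE y); apply/ab.
- by rewrite (wE x) (wE y) !phiE; exact: (phiE (TMeet _ _)).
- by rewrite (wE x) !phiE; exact: (phiE (TAct g _)).
Qed.

Lemma sval_inj (X : Type) (P : X -> Prop) : injective (@proj1_sig X P).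
Proof. by case=> [x xP] [y yP] /= xy; exact: eq_exist. Qed.

Lemma mono_eval A (a : A) (x : mono a) t :
  sval (eval (fun=> x) t) = eval (fun=> sval x) t.
Proof. exact: (@eval_morph _ (mono a) A (fun y => sval y)). Qed.

Lemma mono_generates A (a : A) :
  generates (exist _ a (mono_gen_closed a) : mono a).
Proof.
by move=> [y [t yt]]; exists t; apply: sval_inj; rewrite mono_eval.
Qed.

End UnaryTerms.

(** * Minimal quasivarieties and homogeneous algebras *)

Section Minimality.
Variable G : zmodType.
Implicit Types (A B : gsl G) (R : gclass G).
Implicit Types s t : term G unit.

Lemma Qvar_refl A : Qvar A A.
Proof. by move=> R. Qed.

Lemma Qvar_sub A R : quasivariety R -> R A -> gsubclass (Qvar A) R.
Proof. by move=> qR RA B; apply. Qed.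

Lemma holds_in_quasivariety q : quasivariety (fun A => holds_in A q).
Proof.
exists [set q]%classic; apply/funext => A; apply/propext.
by split=> [Aq _ ->//|]; apply.
Qed.

Lemma Qvar_quasivariety A : quasivariety (Qvar A).
Proof.
exists [set q | holds_in A q]%classic; apply/funext => B; apply/propext.
split=> [AB q Aq|Bq R [S RE]]; first exact: AB (holds_in_quasivariety q) Aq.
by rewrite RE => AS q Sq; apply: Bq; exact: AS.
Qed.

Lemma Qvar_identity A B s t : Qvar A B ->
  (forall x : A, eval (fun=> x) s = eval (fun=> x) t) ->
  forall x : B, eval (fun=> x) s = eval (fun=> x) t.
Proof.
move=> AB Ast; have qv := quasivariety_identity s t (Qvar_quasivariety A).
by have [] := AB _ qv (conj (@Qvar_refl A) Ast).
Qed.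

Lemma MinQVar_Qvar R B : MinQVar R -> R B -> ~ trivial_gsl B -> Qvar B = R.
Proof.
move=> [qR _ minR] RB nB; apply: contrapT => /minR H; apply: nB.
exact: H (Qvar_quasivariety B) (Qvar_sub qR RB) B (@Qvar_refl B).
Qed.

(** 0-homogeneity: the unary equations of a non-zero element are those of the
    generator.  The converse implication, from [a] to [x], is
    [generates_identity]. *)
Definition homogeneous0 A (a : A) : Prop :=
  generates a /\
  forall (x : A) s t, ~ is_zero x ->
    eval (fun=> x) s = eval (fun=> x) t -> eval (fun=> a) s = eval (fun=> a) t.

Definition homogeneous A (a : A) : Prop :=
  generates a /\
  forall (x : A) s t,
    eval (fun=> x) s = eval (fun=> x) t -> eval (fun=> a) s = eval (fun=> a) t.

Lemma homogeneousW A (a : A) : homogeneous a -> homogeneous0 a.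
Proof. by move=> [gen h]; split=> // x s t _; exact: h. Qed.

Lemma homogeneous0_homogeneous A (a : A) :
  ~ (exists o : A, is_zero o) -> homogeneous0 a -> homogeneous a.
Proof.
by move=> nz [gen h]; split=> // x s t; apply: h => xz; apply: nz; exists x.
Qed.

Lemma trivial_homogeneous A : trivial_gsl A -> exists a : A, homogeneous a.
Proof.
move=> [a triv]; exists a; split=> [y|x s t _]; first by exists (Var tt).
by rewrite (triv (eval _ s)) (triv (eval _ t)).
Qed.

(** A zero is fixed by every translation, and homogeneity would transfer
    these equations to the generator. *)
Lemma homogeneous_no_zero A (a : A) :
  homogeneous a -> ~ trivial_gsl A -> ~ exists o : A, is_zero o.
Proof.
move=> [gen h] nA [o oz]; apply: nA; apply: (generates_fixed_trivial gen) => g.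
by apply: (h o (TAct g (Var tt)) (Var tt)); exact: act_zero.
Qed.

Lemma nontrivial_nonzero A : ~ trivial_gsl A -> exists x : A, ~ is_zero x.
Proof.
move=> nA; apply: contrapT => H; apply: nA.
have az (x : A) : is_zero x by apply: contrapT => nx; apply: H; exists x.
case: (carrier_inhabited A) => x; exists x => y.
by apply: zero_min (az x) (az y x).
Qed.

(** If [s(a) <> t(a)], then in [A] the equation [s(x) = t(x)] forces [x] to be
    zero, which is the quasi-identity [s(x) = t(x) => x <= y].  So a non-zero
    element of an algebra of [Q(A)] satisfies no unary equation beyond those of
    [a]. *)
Lemma homogeneous0_emb A B (a : A) :
  homogeneous0 a -> Qvar A B -> ~ trivial_gsl B -> emb A B.
Proof.
move=> [gen h] AB /nontrivial_nonzero [x nx].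
suff : forall s t, eval (fun=> a) s = eval (fun=> a) t <->
                   eval (fun=> x) s = eval (fun=> x) t.
  by move=> /(generates_emb gen) [phi [? ? ? _]]; exists phi.
move=> s t; split=> [/(generates_identity gen) st|st].
  exact: Qvar_identity AB st x.
apply: contrapT => nst; apply: nx => y.
pose f (_ : unit) := 0%N.
pose q := @QuasiIdentity G [:: (rename f s, rename f t)]
            (TMeet (Var 0%N) (Var 1%N), Var 0%N).
have Aq : holds_in A q.
  move=> v /(_ _ (mem_head _ _)); rewrite /= !eval_rename => /(h (v 0%N)) H.
  suff : is_zero (v 0%N) by apply.
  by apply: contrapT => /H.
have /= := AB _ (holds_in_quasivariety q) Aq (fun i => if i == 0%N then x else y).
by apply=> p; rewrite inE => /eqP -> /=; rewrite !eval_rename.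
Qed.

(** A nontrivial subquasivariety contains a nontrivial algebra, hence a copy
    of [A]. *)
Lemma homogeneous0_MinQVar A (a : A) :
  homogeneous0 a -> ~ trivial_gsl A -> MinQVar (Qvar A).
Proof.
move=> ha nA; split; first exact: Qvar_quasivariety.
  by move/(_ A (@Qvar_refl A)).
move=> S qS SA nS B SB; apply: contrapT => nB; apply: nS.
apply/funext => C; apply/propext; split=> [/SA//|]; apply: Qvar_sub => //.
have [phi [phiI phiM phiA]] := homogeneous0_emb ha (SA B SB) nB.
exact: quasivariety_emb phiM phiA phiI qS SB.
Qed.

Lemma free1_generates R : generates (gen1 R).
Proof. exact: free1_eval. Qed.

(** The free algebra of [Q(A)] on one generator is [A] itself when [A] is
    monogenic: both satisfy the same equations at their generators. *)
Lemma free1_Qvar A (a : A) s t : generates a ->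
  eval (fun=> gen1 (Qvar A)) s = eval (fun=> gen1 (Qvar A)) t <->
  eval (fun=> a) s = eval (fun=> a) t.
Proof.
move=> gen; rewrite !eval_gen1; split.
  by move=> /free_eq; apply; exact: Qvar_refl.
move=> /(generates_identity gen) st; apply/free_eq => B AB x.
exact: Qvar_identity AB st x.
Qed.

(** A non-zero [x] is not fixed by [G], so it generates a nontrivial
    subalgebra; by minimality the unary equations of [x] hold throughout [R]. *)
Lemma free1_homogeneous0 R :
  MinQVar R -> ~ trivial_gsl (free1 R) -> homogeneous0 (gen1 R).
Proof.
move=> mR nF; split=> [|x s t nx st]; first exact: free1_generates.
have [qR _ _] := mR; have Rx := mono_in x qR (free1_in qR).
have nmx : ~ trivial_gsl (mono x).
  move=> [y ally]; apply: nx.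
  apply: (generates_fixed_zero (@free1_generates R)) => g.
  have xx := mono_gen_closed x.
  have := ally (exist _ _ (mono_act_closed g xx)).
  by rewrite -(ally (exist _ _ xx)) => -[].
have /Qvar_identity : Qvar (mono x) (free1 R).
  by rewrite (MinQVar_Qvar mR Rx nmx); exact: free1_in.
apply; apply: (generates_identity (@mono_generates _ _ x)).
by apply: sval_inj; rewrite !mono_eval.
Qed.

End Minimality.

Lemma inj_surj_bij (X Y : Type) (f : X -> Y) :
  injective f -> (forall y, exists x, y = f x) -> bijective f.
Proof.
move=> fI /choice [g gK]; exists g => [x|y]; last by rewrite -gK.
by apply: fI; rewrite -gK.
Qed.

Lemma iso_homogeneous (G : zmodType) (A B : gsl G) (b : B) :
  iso A B -> homogeneous b -> exists a : A, homogeneous a.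
Proof.
move=> [phi [[psi phiK psiK] phiM phiA]] [gen h]; exists (psi b).
have E (x : A) t : phi (eval (fun=> x) t) = eval (fun=> phi x) t.
  by rewrite eval_morph.
split=> [y|x s t st].
  have [t yt] := gen (phi y); exists t.
  by rewrite -[LHS]phiK -[RHS]phiK E psiK yt.
by apply: (can_inj phiK); rewrite !E psiK; apply: (h (phi x)); rewrite -!E st.
Qed.

(** * Subgroups *)

Section Subgroups.
Variable G : zmodType.
Implicit Types K : zmodClosed G.

Fixpoint lift K X (t : term (subgrp K) X) : term G X :=
  match t with
  | Var x => Var x
  | TMeet s t => TMeet (lift s) (lift t)
  | TAct k t => TAct (val k) (lift t)
  end.

(** The terms of the sublanguage of [P], as a condition on terms over [G].
    Unlike the type of terms over a subgroup, it can be compared between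
    subgroups that have the same elements but are different structures. *)
Fixpoint over (P : {pred G}) X (t : term G X) : Prop :=
  match t with
  | Var x => True
  | TMeet s t => over P s /\ over P t
  | TAct g t => g \in P /\ over P t
  end.

Lemma over_lift K X (t : term (subgrp K) X) : over K (lift t).
Proof. by elim: t => [x|s IHs t IHt|k t IHt] //=; split=> //; exact: valP. Qed.

Lemma overP K X (t : term G X) :
  over K t -> exists t' : term (subgrp K) X, lift t' = t.
Proof.
elim: t => [x|s IHs t IHt|g t IHt] /=; first by exists (Var x).
  by move=> [/IHs [s' <-] /IHt [t' <-]]; exists (TMeet s' t').
by move=> [gK /IHt [t' <-]]; exists (TAct (Sub g gK : subgrp K) t').
Qed.

Lemma over_sub (P Q : {pred G}) X (t : term G X) :
  {subset P <= Q} -> over P t -> over Q t.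
Proof.
move=> PQ; elim: t => [x|s IHs t IHt|g t IHt] //=.
  by move=> [/IHs ? /IHt ?].
by move=> [/PQ ? /IHt ?].
Qed.

Lemma over_all (P : {pred G}) X (t : term G X) :
  (forall g, g \in P) -> over P t.
Proof. by move=> PT; elim: t => [x|s IHs t IHt|g t IHt] /=. Qed.

Lemma eval_reduct K (A : gsl G) X (v : X -> A) (t : term (subgrp K) X) :
  eval (A := reduct K A) v t = eval v (lift t).
Proof. by elim: t => [x|s /= -> t ->|k t /= ->]. Qed.

Lemma over_le_act K (A : gsl G) (x : A) (t : term G unit) : over K t ->
  exists2 k, k \in K & gle (eval (fun=> x) t) (act k x).
Proof.
elim: t => [[] _|s IHs t _ [/IHs [k kK sk] _]|h t IHt [hK /IHt [k kK tk]]] /=.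
- by exists 0; [exact: rpred0|rewrite act0; exact: gle_refl].
- by exists k => //; apply: gle_trans sk; exact: gle_meetl.
- by exists (h + k); [exact: rpredD|rewrite -actD; exact: gle_act].
Qed.

(** A nontrivial homogeneous [U] has no zero and is the free algebra of the
    minimal quasivariety it generates; its group [K] is nontrivial, because
    over the trivial group monogenic algebras are trivial. *)
Lemma DG_homogeneous (d : gpair G) :
  DG d <-> ~ (forall g, g \in projT1 d) /\ exists u : projT2 d, homogeneous u.
Proof.
case: d => K U; rewrite /DG /=; split=> [[nK [triv|[_ [S [[mS nz] US]]]]]|].
- by split=> //; exact: trivial_homogeneous.
- split=> //; apply: iso_homogeneous US _; apply: (homogeneous0_homogeneous nz).
  apply: free1_homogeneous0 => // -[x allx]; apply: nz; exists x => y.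
  by rewrite (allx y); exact: gle_refl.
move=> [nK [u hu]]; split=> //.
have [triv|nU] := pselect (trivial_gsl U); [by left|right].
split=> [K0|].
  apply: nU; apply: (generates_fixed_trivial hu.1) => g.
  have g0 : g = 0 by apply: val_inj; exact: K0 (valP g).
  by rewrite g0 act0.
have [phi [phiI phiM phiA phiE]] := generates_emb hu.1
  (fun s t => iff_sym (@free1_Qvar _ _ u s t hu.1)).
have iU : iso U (free1 (Qvar U)).
  exists phi; split=> //; apply: inj_surj_bij => // y.
  by have [t ->] := free1_generates y; exists (eval (fun=> u) t).
exists (Qvar U); split=> //; split.
  by apply: homogeneous0_MinQVar nU; exact: homogeneousW hu.
move=> [o oz]; apply: (homogeneous_no_zero hu nU).
case: iU => chi [[psi chiK psiK] chiM _]; exists (psi o) => x.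
by apply: (can_inj chiK); rewrite chiM psiK; exact: oz.
Qed.

End Subgroups.

(** * The pair of a quasivariety *)

Section Gamma.
Variables (G : zmodType) (R : gclass G) (hR : MinQVar0 R).
Let a := gen1 R.
Implicit Types s t : term G unit.

Lemma MinQVar0_nontrivial : ~ trivial_gsl (free1 R).
Proof.
by case: hR => _ _ [x [y xy]] [z allz]; apply: xy; rewrite (allz x) (allz y).
Qed.

Lemma MinQVar0_homogeneous0 : homogeneous0 a.
Proof.
by apply: free1_homogeneous0; [case: hR|exact: MinQVar0_nontrivial].
Qed.

(** If [meet b (act g b)] were the zero [o = t(a)], then [b] would satisfy the
    equation [meet x (act g x) = t(x)], as [t(b) <= o]; so would [a], by
    0-homogeneity. *)
Lemma KR_meet_neq0 (o b : free1 R) g :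
  is_zero o -> b <> o -> g \in KR hR -> meet b (act g b) <> o.
Proof.
move=> oz b0 /(KRP _ _ oz) ag bg; apply: ag.
have [gen h] := MinQVar0_homogeneous0; have [t ot] := gen o.
have tb : eval (fun=> b) t = o.
  apply: (zero_min oz); have [s ->] := gen b.
  have [k le_k] := eval_le_act s a; rewrite -(act_zero k oz) ot -eval_act.
  exact: gle_eval.
rewrite [in RHS]ot.
apply: (h b (TMeet (Var tt) (TAct g (Var tt))) t); last first.
  exact: etrans bg (esym tb).
by move=> bz; apply: b0; exact: zero_min oz (bz o).
Qed.

(** Meets of non-zero elements may vanish, so non-vanishing of terms is not
    inductive.  A common non-zero lower bound of [b] and [t(b)] is: for a
    meet it is built by applying the induction hypothesis for the second term
    at the bound found for the first one. *)
Lemma KR_term_below (o b : free1 R) t : is_zero o -> b <> o ->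
  over (KR hR) t -> exists c, [/\ c <> o, gle c b & gle c (eval (fun=> b) t)].
Proof.
move=> oz; elim: t b => [[]|s IHs t IHt|g t IHt] b b0 /=.
- by exists b; split=> //; exact: gle_refl.
- move=> [/(IHs b b0) [c [c0 cb cs]] /(IHt c c0) [c' [c'0 c'c c't]]].
  exists c'; split=> //; first exact: gle_trans c'c cb.
  rewrite -(meetxx c'); apply: gle_meet2; first exact: gle_trans c'c cs.
  by apply: gle_trans c't _; exact: gle_eval.
- move=> [gK /(IHt b b0) [c [c0 cb ct]]]; exists (meet c (act g c)).
  split; first exact: KR_meet_neq0.
    by apply: gle_trans cb; exact: gle_meetl.
  by apply: gle_trans (gle_act g ct); exact: gle_meetr.
Qed.

Lemma KR_term_neq0 (o : free1 R) t :
  is_zero o -> over (KR hR) t -> eval (fun=> a) t <> o.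
Proof.
move=> oz /(KR_term_below oz (gen1_neq0 hR oz)) [c [c0 _ ct]] ao.
by apply: c0; apply: zero_min oz _; rewrite -ao.
Qed.

(** The zero of the free algebra is the value of some term at the generator,
    which would be a term over [K_R]. *)
Lemma KR_proper : ~ (forall g, g \in KR hR).
Proof.
move=> KG; have [_ [o oz] _] := hR; have [t ot] := free1_generates o.
exact: (KR_term_neq0 oz (over_all t KG)).
Qed.

Lemma UR_eval (x : UR hR) (t : term (subgrp (KR hR)) unit) :
  sval (eval (fun=> x) t) = eval (fun=> sval x : free1 R) (lift t).
Proof. by rewrite mono_eval eval_reduct. Qed.

Lemma UR_term (x : UR hR) :
  exists2 t : term G unit, over (KR hR) t & sval x = eval (fun=> a) t.
Proof.
case: x => x /= [t ->]; exists (lift t); first exact: over_lift.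
by rewrite eval_reduct.
Qed.

Lemma UR_neq0 (x : UR hR) (o : free1 R) : is_zero o -> sval x <> o.
Proof. by have [t tK ->] := UR_term x => oz; exact: KR_term_neq0. Qed.

Lemma UR_homogeneous :
  homogeneous (exist _ _ (mono_gen_closed (a : reduct (KR hR) (free1 R))) : UR hR).
Proof.
split=> [|x s t st]; first exact: mono_generates.
have [_ [o oz] _] := hR; have [_ h] := MinQVar0_homogeneous0.
apply: sval_inj; rewrite !UR_eval /=; apply: (h (sval x)).
  by move=> xz; apply: (@UR_neq0 x o oz); exact: zero_min oz (xz o).
by rewrite -!UR_eval st.
Qed.

(** Elements of [U_R] lie below translates of [a] by [K_R], and translates of
    [a] by different cosets of [K_R] meet in [o]. *)
Lemma UR_meet_notin (u v : UR hR) g (o : free1 R) : is_zero o ->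
  g \notin KR hR -> meet (sval u : free1 R) (act g (sval v)) = o.
Proof.
move=> oz gK.
have below (x : UR hR) : exists2 k, k \in KR hR & gle (sval x : free1 R) (act k a).
  by have [t tK ->] := UR_term x; exact: over_le_act.
have [k kK uk] := below u; have [l lK vl] := below v.
have : meet a (act (g + l - k) a) = o.
  apply: contrapT => /(KRP hR _ oz) glk; move/negP: gK; apply.
  have -> : g = (g + l - k) + (k - l) by rewrite addrA subrK addrK.
  by rewrite rpredD// rpredB.
move/(congr1 (act k)); rewrite -act_meet actD [k + _]addrC subrK (act_zero k oz).
move=> kgl; apply: (zero_min oz); rewrite -kgl -actD.
by apply: gle_meet2 => //; exact: gle_act.
Qed.

End Gamma.

(** * The algebra N(K, G, U) *)

Section N.
Variables (G : zmodType) (K : zmodClosed G) (T : coset_transversal K).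
Variable U : gsl (subgrp K).
Implicit Types (u v : U) (t : {t : G | tset T t}).

Notation N := (Nsl T U).

(** [Nelt] names the non-zero elements, so that rewriting sees them as elements
    of the algebra and not as a bare option. *)
Definition Nelt u t : N := Some (u, t).

Definition Norigin : {t : G | tset T t} :=
  exist _ 0 ((tset_K T 0).2 erefl).1.

Lemma Nelt_inj t : injective (Nelt^~ t).
Proof. by move=> u v []. Qed.

Lemma N_zero : is_zero (None : N).
Proof. by []. Qed.

Lemma tset_eq t t' : sval t - sval t' \in K -> t = t'.
Proof.
move=> tt'; apply: sval_inj; rewrite -(trep_uniq (svalP t) tt').
by apply: trep_uniq (svalP t') _; rewrite subrr rpred0.
Qed.

Lemma N_act_sub (k : subgrp K) u t : act (val k) (Nelt u t) = Nelt (act k u) t.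
Proof.
have tt : trep T (val k + sval t) = sval t.
  by apply: trep_uniq (svalP t) _; rewrite opprD addrCA subrr addr0 rpredN (valP k).
by apply: N_act_eq; rewrite /= tt // addrK.
Qed.

Lemma N_meet_elt u v t : meet (Nelt u t) (Nelt v t) = Nelt (meet u v) t.
Proof. by rewrite /= asboolT. Qed.

Lemma N_meet_neq u v t t' : t <> t' -> meet (Nelt u t) (Nelt v t') = None.
Proof. by move=> tt'; rewrite /= asboolF. Qed.

Lemma N_meet_notin g u v t :
  g \notin K -> meet (act g (Nelt u t)) (Nelt v t) = None.
Proof.
move=> gK; apply: N_meet_neq => /(congr1 sval) /= tt; move/negP: gK; apply.
by have := trep_coset T (g + sval t); rewrite tt addrK.
Qed.

Lemma N_act_origin u t : act (sval t) (Nelt u Norigin) = Nelt u t.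
Proof.
have tt : trep T (sval t + 0) = sval t.
  by apply: trep_uniq (svalP t) _; rewrite addr0 subrr rpred0.
by rewrite -[in RHS](act0 u); apply: N_act_eq; rewrite /= tt // addr0 subrr.
Qed.

Lemma eval_Nelt (s : term (subgrp K) unit) u t :
  eval (fun=> Nelt u t) (lift s) = Nelt (eval (fun=> u) s) t.
Proof.
elim: s => [[]|s IHs s' IHs'|k s IHs] //=.
- by rewrite IHs IHs'; exact: N_meet_elt.
- by rewrite IHs; exact: N_act_sub.
Qed.

(** A term is a meet of translates; it survives in [N] exactly when all the
    translations lie in one coset [c + K], and then it is the translate by [c]
    of a term over [K]. *)
Lemma N_term_normal (s : term G unit) :
  (forall u t, eval (fun=> Nelt u t) s = None) \/
  exists c (s' : term (subgrp K) unit),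
    forall u t, eval (fun=> Nelt u t) s = act c (Nelt (eval (fun=> u) s') t).
Proof.
elim: s => [[]|s IHs r IHr|g s IHs].
- by right; exists 0, (Var tt) => u t; rewrite act0.
- case: IHs => [s0|[c [s' sE]]]; first by left=> u t /=; rewrite s0.
  case: IHr => [r0|[d [r' rE]]].
    by left=> u t /=; rewrite r0; exact: zero_min N_zero (gle_meetr _ _).
  have E u t : eval (fun=> Nelt u t) (TMeet s r) =
    act d (meet (act (c - d) (Nelt (eval (fun=> u) s') t))
                (Nelt (eval (fun=> u) r') t)).
    by rewrite -act_meet actD addrC subrK -sE -rE.
  have [cdK|cdK] := boolP (c - d \in K).
    right; exists d, (TMeet (TAct (Sub (c - d) cdK : subgrp K) s') r') => u t.
    by rewrite E -N_meet_elt -N_act_sub.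
  by left=> u t; rewrite E N_meet_notin// act_zero//; exact: N_zero.
- case: IHs => [s0|[c [s' sE]]]; [left|right] => [u t|].
    by rewrite /= s0.
  by exists (g + c), s' => u t; rewrite -actD -sE.
Qed.

Lemma act_Nelt_neq g u t : act g (Nelt u t) <> None.
Proof. by []. Qed.

(** The zero is generated because [K] is proper: the generator is orthogonal to
    its translate by an element outside [K].  Two terms that agree at a
    non-zero element have both vanishing normal forms, or normal forms with
    translations in the same coset, and homogeneity of [U] applies. *)
Lemma N_homogeneous0 (u0 : U) :
  ~ (forall g, g \in K) -> homogeneous u0 -> homogeneous0 (Nelt u0 Norigin).
Proof.
move=> nK [gen h]; split=> [[[u t]|]|].
- have [s us] := gen u; exists (TAct (sval t) (lift s)) => /=.
  by rewrite eval_Nelt -us; exact/esym/N_act_origin.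
- have [g gK] : exists g, g \notin K.
    apply: contrapT => H; apply: nK => g; apply: contrapT => /negP gK.
    by apply: H; exists g.
  exists (TMeet (TAct g (Var tt)) (Var tt)).
  exact: esym (N_meet_notin u0 u0 Norigin gK).
move=> [[u t]|] s r nz; last by case: nz; exact: N_zero.
rewrite -[Some (u, t)]/(Nelt u t).
have [s0|[c [s' sE]]] := N_term_normal s;
  have [r0|[d [r' rE]]] := N_term_normal r; first by rewrite !s0 !r0.
- by rewrite !s0 !rE => /esym E; case: (act_Nelt_neq E).
- by rewrite !sE !r0 => E; case: (act_Nelt_neq E).
(* Moving [d] to the left compares the K-terms up to a translation [c - d],
   which lies in [K] as otherwise the two sides would be orthogonal. *)
rewrite !sE !rE => /(congr1 (act (- d))); rewrite !actD addNr !act0 addrC => cd.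
have [cdK|cdK] := boolP (c - d \in K); last first.
  have := N_meet_notin (eval (fun=> u) s') (eval (fun=> u) r') t cdK.
  by rewrite cd meetxx.
pose k : subgrp K := Sub (c - d) cdK.
have /Nelt_inj kE :
    Nelt (eval (fun=> u) (TAct k s')) t = Nelt (eval (fun=> u) r') t.
  by rewrite -cd -N_act_sub.
by rewrite -(h u _ _ kE) -N_act_sub actD addrC subrK.
Qed.

(** The pair [(u, t)] is the translate by [t] of [(u, 0)], so it must go to the
    translate of [psi u]; the orthogonality hypothesis makes this respect the
    meets between different cosets. *)
Lemma N_emb (B : gsl G) (o : B) (psi : U -> B) :
  is_zero o -> injective psi -> {morph psi : u v / meet u v} ->
  (forall (k : subgrp K) u, psi (act k u) = act (val k) (psi u)) ->
  (forall u, psi u <> o) ->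
  (forall g u v, g \notin K -> meet (psi u) (act g (psi v)) = o) ->
  emb N B.
Proof.
move=> oz psiI psiM psiA psi0 psiK.
pose phi (x : N) : B := if x is Some (u, t) then act (sval t) (psi u) else o.
have phiM : {morph phi : x y / meet x y}.
  move=> [[u t]|] [[v t']|] /=.
  - case: asboolP => [<-|tt'] /=; first by rewrite psiM act_meet.
    have tK : sval t' - sval t \notin K.
      by apply/negP => /tset_eq /esym.
    have := congr1 (act (sval t)) (psiK _ u v tK).
    rewrite -act_meet actD addrC subrK (act_zero _ oz) => E; exact: esym E.
  - exact: esym (zero_min oz (gle_meetr _ _)).
  - exact: esym (oz _).
  - exact: esym (oz _).
have phi0 u t : phi (Nelt u t) <> o.
  move=> /= H; apply: (psi0 u); apply: (@act_inj _ _ (sval t)).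
  by rewrite H (act_zero _ oz).
exists phi; split=> // [x y xy|g x].
  (* Injectivity reduces to order reflection, where the meet of the two
     elements can be compared with one of them. *)
  have le (z w : N) : phi z = phi w -> gle z w.
    case: z w => [[u t]|] [[v t']|] //= => [E|/phi0//].
    have : phi (meet (Nelt u t) (Nelt v t')) = phi (Nelt u t).
      by rewrite phiM /= -E meetxx.
    rewrite /gle; have [<-|tt'] := pselect (t = t').
      by rewrite !N_meet_elt /= => /act_inj /psiI ->.
    by rewrite !N_meet_neq// => /esym /phi0.
  by apply: gle_anti; apply: le.
case: x => [[u t]|]; last exact: esym (act_zero g oz).
by rewrite /= psiA !actD /= addrC subrK.
Qed.

End N.

Lemma N_nontrivial (G : zmodType) (K : zmodClosed G) (T : coset_transversal K)
  (U : gsl (subgrp K)) : ~ trivial_gsl (Nsl T U).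
Proof.
case: (carrier_inhabited U) => u -[x allx].
have := allx (Nelt u (Norigin T)).
by rewrite -(allx None).
Qed.

Lemma emb_Qvar (G : zmodType) (A B : gsl G) : emb A B -> Qvar B A.
Proof.
move=> [phi [phiI phiM phiA]] R qR.
exact: quasivariety_emb phiM phiA phiI qR.
Qed.

(** * The mutually inverse maps *)

Section Delta.
Variables (G : zmodType) (T : forall K : zmodClosed G, coset_transversal K).

Lemma delta_MinQVar0 (d : gpair G) : DG d -> MinQVar0 (delta T d).
Proof.
move=> /DG_homogeneous [nK [u hu]]; rewrite /delta; set N := Nsl _ _.
have hN := N_homogeneous0 (T (projT1 d)) nK hu.
have nN : ~ trivial_gsl N := @N_nontrivial _ _ _ _.
have [phi [phiI phiM phiA phiE]] := generates_emb hN.1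
  (fun s t => iff_sym (@free1_Qvar _ _ _ s t hN.1)).
split; first exact: homogeneous0_MinQVar hN nN.
- exists (phi None) => x; have [t ->] := free1_generates x.
  by rewrite -phiE /gle -phiM.
- by exists (phi None), (phi (Nelt u (Norigin (T (projT1 d))))) => /phiI.
Qed.

Lemma gpair_eq_sym (d d' : gpair G) : gpair_eq d d' -> gpair_eq d' d.
Proof.
move=> [KK [phi [[psi phiK psiK] phiM phiA]]]; split=> [g|]; first by rewrite KK.
exists psi; split=> [|x y|k k' kk' x]; first by exists phi.
  by apply: (can_inj phiK); rewrite phiM !psiK.
by apply: (can_inj phiK); rewrite psiK (phiA _ k) ?psiK.
Qed.

Lemma delta_sub (d d' : gpair G) :
  gpair_eq d d' -> gsubclass (delta T d) (delta T d').
Proof.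
move=> [KK [phi [phiB phiM phiA]]].
apply: Qvar_sub; first exact: Qvar_quasivariety.
apply: emb_Qvar; set N := Nsl _ (projT2 d').
apply: (@N_emb _ _ _ _ N None
  (fun u => Nelt (phi u) (Norigin (T (projT1 d'))))) => //.
- by move=> u v /Nelt_inj; exact: bij_inj.
- by move=> u v; rewrite phiM N_meet_elt.
- move=> k u; have kK : val k \in projT1 d' by rewrite -KK; exact: valP.
  by rewrite (phiA k (Sub (val k) kK)) // -N_act_sub.
- by move=> g u v gK; rewrite meetC N_meet_notin// -KK.
Qed.

Lemma delta_eq (d d' : gpair G) : gpair_eq d d' -> delta T d = delta T d'.
Proof.
move=> dd'; apply/funext => A; apply/propext.
by split; apply: delta_sub => //; exact: gpair_eq_sym.
Qed.

(** [N(K_R, G, U_R)] embeds in the free algebra, so it is a nontrivial algebra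
    of the minimal quasivariety [R]. *)
Lemma delta_gamma (R : gclass G) (hR : MinQVar0 R) : delta T (gamma hR) = R.
Proof.
have [mR [o oz] _] := hR; have [qR _ _] := mR.
apply: MinQVar_Qvar => //; last exact: N_nontrivial.
have RF := free1_in qR; apply: (emb_Qvar _ qR RF).
apply: (@N_emb _ _ _ (UR hR) (free1 R) o (fun x => sval x)) => //.
- exact: sval_inj.
- by move=> x; exact: UR_neq0.
- by move=> g u v; exact: UR_meet_notin.
Qed.

(** The free algebra of [Q(N)] is [N], with free generator [(u0, 0)].  Its
    translates that meet it outside zero are those by [K], and the values of
    K-terms at it are the pairs [(u, 0)]. *)
Lemma gamma_delta (d : gpair G) (hR : MinQVar0 (delta T d)) :
  DG d -> gpair_eq (gamma hR) d.
Proof.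
case: d hR => K U hR /DG_homogeneous /= [nK [u0 hu]].
pose N := Nsl (T K) U; pose base u : N := Nelt u (Norigin (T K)).
have baseI : injective base by move=> u v /Nelt_inj.
have hN := N_homogeneous0 (T K) nK hu.
have [Phi [PhiI PhiM PhiA PhiE]] := generates_emb (@free1_generates _ (Qvar N))
  (fun s t => @free1_Qvar _ _ _ s t hN.1).
have [_ [o oz] _] := hR.
have Phi0 : Phi o = None.
  have [t t0] := hN.1 None; apply: (zero_min (@N_zero _ _ _ _)).
  rewrite t0 -PhiE /gle -PhiM; congr Phi; exact: oz.
have genE : Phi (gen1 _) = base u0 := PhiE (Var tt).
have KK : KR hR =i K.
  move=> g; apply/(KRP hR g oz)/idP => [H|gK].
    apply: contrapT => /negP gK; apply: H; apply: PhiI.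
    by rewrite PhiM PhiA genE Phi0 meetC N_meet_notin.
  move=> /(congr1 Phi); rewrite PhiM PhiA genE Phi0.
  by rewrite (N_act_sub (Sub g gK : subgrp K)) N_meet_elt.
split=> //=.
have /choice [phi phiE] : forall x : UR hR, exists u, Phi (sval x) = base u.
  move=> x.
  have [t tK ->] := UR_term x.
  have [s <-] : exists s : term (subgrp K) unit, lift s = t.
    by apply: overP; apply: over_sub tK => g; rewrite KK.
  by exists (eval (fun=> u0) s); rewrite PhiE eval_Nelt.
exists phi; split.
- apply: inj_surj_bij => [x y xy|u].
    by apply: sval_inj; apply: PhiI; rewrite !phiE xy.
  have [s us] := hu.1 u.
  have [t tE] : exists t : term (subgrp (KR hR)) unit, lift t = lift s.
    by apply: overP; apply: over_sub (over_lift s) => g; rewrite KK.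
  pose a : UR hR := exist _ _ (mono_gen_closed (gen1 _ : reduct (KR hR) _)).
  exists (eval (fun=> a) t); apply: baseI.
  by rewrite -phiE UR_eval tE PhiE eval_Nelt -us.
- move=> x y; apply: baseI.
  by rewrite /base -N_meet_elt -!/(base _) -!phiE -PhiM.
- move=> k k' kk' x; apply: baseI.
  rewrite -phiE; apply: etrans (PhiA (val k) (sval x)) _.
  by apply: etrans (congr2 act kk' (phiE x)) _; exact: N_act_sub.
Qed.

End Delta.

Theorem theorem7p3 (G : zmodType)
    (T : forall K : zmodClosed G, coset_transversal K) :
  [/\ (* gamma maps MinQVar_0(G) to D(G) *)
      forall (R : gclass G) (hR : MinQVar0 R), DG (gamma hR),
      (* delta maps D(G) to MinQVar_0(G), and is well defined on pairs whose
         second component is taken up to isomorphism *)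
      forall d : gpair G, DG d -> MinQVar0 (delta T d),
      forall d d' : gpair G, DG d -> gpair_eq d d' -> delta T d = delta T d',
      (* the maps are mutually inverse *)
      forall (R : gclass G) (hR : MinQVar0 R), delta T (gamma hR) = R
    & forall (d : gpair G) (hR : MinQVar0 (delta T d)),
        DG d -> gpair_eq (gamma hR) d].
Proof.
split.
- move=> R hR; apply/DG_homogeneous; split; first exact: KR_proper.
  by eexists; exact: UR_homogeneous.
- exact: delta_MinQVar0.
- by move=> d d' _; exact: delta_eq.
- exact: delta_gamma.
- exact: gamma_delta.
Qed.
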